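(* Let $y\in\mathbb{R}^m$ and let $\psi\in\mathbb{R}^m$ be given by $\psi_i=y_i^2$. If $\psi$ has at least $n$ non-zero entries, then the PLS shrinkage vector $\omega$ associated with $y$ satisfies $$\omega=\Big(\sum_{\tau\in[m,n]}\psi^\tau\pi_\tau\Big)^{-1}\sum_{\tau\in[m,n]}\psi^\tau\pi_\tau\,\omega_{(\tau)},\qquad\text{where}\qquad \pi_\tau=\lambda^\tau\prod_{\{j<i\}\subseteq\tau}(\lambda_i-\lambda_j)^2 .$$
   Context: Let $1\le n<m$ be integers and let $\lambda_1>\lambda_2>\cdots>\lambda_m>0$ be real numbers; $\Lambda=\operatorname{diag}(\lambda)$. $\mathbf 1$ is the all-ones vector (of the appropriate length). $V$ is the $m\times n$ Vandermonde matrix $V=(\mathbf 1\;\;\Lambda\mathbf 1\;\cdots\;\Lambda^{n-1}\mathbf 1)$, i.e. $V_{i,k}=\lambda_i^{k-1}$. For $y\in\mathbb{R}^m$ with at least $n$ non-zero entries put $\psi_i=y_i^2$, $\Psi=\operatorname{diag}(\psi)$; then $V^T\Psi\Lambda V$ is non-singular and the PLS shrinkage vector is $\omega=Q\mathbf 1$ with $Q=\Lambda V(V^T\Psi\Lambda V)^{-1}V^T\Psi$. $[m]=\{1,\dots,m\}$ and $[m,n]$ is the set of all $n$-element subsets of $[m]$. For $x\in\mathbb{R}^m$ and $\tau\subseteq[m]$, $x^\tau=\prod_{i\in\tau}x_i$. For $\tau\in[m,n]$, $S_\tau$ is the $m\times n$ selection matrix such that $S_\tau^Tx=x_\tau$ is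 the subvector of $x$ with the entries indexed by $\tau$. The product over $\{j<i\}\subseteq\tau$ runs over all pairs $j<i$ of elements of $\tau$ (an empty product is $1$). For $\tau\in[m,n]$, $\omega_{(\tau)}=\Lambda V(S_\tau^T\Lambda V)^{-1}\mathbf 1\in\mathbb{R}^m$. *)

(* Defs.v *)
From HB Require Import structures.
From mathcomp Require Import all_boot all_order all_algebra.

Set Implicit Arguments.
Unset Strict Implicit.
Unset Printing Implicit Defensive.

Import Order.TTheory GRing.Theory Num.Theory.
Local Open Scope ring_scope.

Section PLS.

Variable R : realFieldType.
Implicit Types (m n : nat).

Definition ones m : 'cV[R]_m := const_mx 1.

(* Vectors of R^m are columns, whereas diag_mx expects a row. *)
Definition diagc m (x : 'cV[R]_m) : 'M[R]_m := diag_mx x^T.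

(* The library's Vandermonde matrix has one column per node. *)
Definition vandermonde m n (lam : 'cV[R]_m) : 'M[R]_(m, n) :=
  (Vandermonde n lam^T)^T.

Definition psi m (y : 'cV[R]_m) : 'cV[R]_m := \col_i (y i 0) ^+ 2.

Definition pls_Q m n (lam y : 'cV[R]_m) : 'M[R]_m :=
  let L := diagc lam in
  let P := diagc (psi y) in
  let V := vandermonde n lam in
  L *m V *m invmx (V^T *m P *m L *m V) *m V^T *m P.

Definition pls_shrinkage m n (lam y : 'cV[R]_m) : 'cV[R]_m :=
  pls_Q n lam y *m ones m.

Definition nsubsets m n : {set {set 'I_m}} := [set tau : {set 'I_m} | #|tau| == n].

Definition subset_prod m (x : 'cV[R]_m) (tau : {set 'I_m}) : R :=
  \prod_(i in tau) x i 0.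

(* Column k is the unit vector of the k-th element of tau in increasing order;
   this is the selection matrix of tau when #|tau| = n. *)
Definition selmx m n (tau : {set 'I_m}) : 'M[R]_(m, n) :=
  \matrix_(i < m, k < n) (onth (enum tau) k == Some i)%:R.

Definition omega_sub m n (lam : 'cV[R]_m) (tau : {set 'I_m}) : 'cV[R]_m :=
  let L := diagc lam in
  let V := vandermonde n lam in
  L *m V *m invmx ((selmx n tau)^T *m L *m V) *m ones n.

Definition pi_weight m (lam : 'cV[R]_m) (tau : {set 'I_m}) : R :=
  subset_prod lam tau *
  \prod_(i in tau) \prod_(j in tau | (j < i)%N) (lam i 0 - lam j 0) ^+ 2.

End PLS.

(* Main.v *)
(* By Cramer's rule the entries of adj(M) b, with M = V^T Psi Lam V and
   b = V^T Psi 1, are determinants of products (V^T Psi) Y, where Y is Lam V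
   with one column replaced by 1.  Expanding these and det M by Cauchy-Binet
   over the n-subsets tau, the factor det(V^T Psi S) is psi^tau det(S^T V),
   and Cramer's rule read backwards on each S^T Lam V yields omega_(tau) with
   weight psi^tau det(S^T V) det(S^T Lam V) = psi^tau pi_tau. *)
Require Import Defs.
From HB Require Import structures.
From mathcomp Require Import all_boot all_order all_algebra.
From mathcomp Require Import perm.

Set Implicit Arguments.
Unset Strict Implicit.
Unset Printing Implicit Defensive.

Import Order.TTheory GRing.Theory Num.Theory.
Local Open Scope ring_scope.

(** * Selection matrices and the Cauchy-Binet formula *)

Section Selection.

Variables (R : realFieldType) (m : nat).
Implicit Types (tau : {set 'I_m}) (x lam : 'cV[R]_m).

(** Holds because [enum tau] filters the increasing list [enum 'I_m]. It matches pairs of elements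
    of [tau] with pairs of row indices in the Vandermonde product. *)
Lemma ltn_enum_val tau : {mono @enum_val _ (mem tau) : i j / (i < j)%N}.
Proof.
have homo : {homo @enum_val _ (mem tau) : i j / (i < j)%N}.
  move=> i j ltij; pose x0 := enum_val i.
  rewrite (enum_val_nth x0 i) (enum_val_nth x0 j).
  have tr : transitive (relpre (@nat_of_ord m) ltn).
    by move=> ? ? ?; apply: ltn_trans.
  apply: (sorted_ltn_nth tr); rewrite ?inE -?cardE //.
  rewrite [enum _](_ : _ = filter (mem tau) (enum 'I_m)); last first.
    by rewrite !enumT.
  by apply: sorted_filter => //; rewrite -sorted_map val_enum_ord iota_ltn_sorted.
move=> i j; case: (ltngtP i j) => [/homo->//|/homo lt|eqij].
  by apply: contraTF lt; rewrite -leqNgt => /ltnW.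
by rewrite (ord_inj eqij) ltnn.
Qed.

(** The cast keeps the index type ['I_n], as needed for the rows of n by n minors. *)
Lemma big_enum_val_cast (T : Type) (idx : T) (op : Monoid.com_law idx) n tau
    (ntau : #|tau| = n) (F : 'I_m -> T) :
  \big[op/idx]_(i in tau) F i =
  \big[op/idx]_(k < n) F (enum_val (cast_ord (esym ntau) k)).
Proof.
rewrite big_enum_val /=; case: n / ntau.
by apply: eq_bigr => k _; rewrite cast_ord_id.
Qed.

Lemma tr_selmxE n tau (ntau : #|tau| = n) i j :
  (selmx R n tau)^T i j = (enum_val (cast_ord (esym ntau) i) == j)%:R.
Proof.
case: n / ntau i => i; rewrite !mxE cast_ord_id.
rewrite onthE (nth_map (enum_val i)) -?cardE // -enum_val_nth.
by [].
Qed.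

Lemma mul_tr_selmx n p tau (ntau : #|tau| = n) (A : 'M[R]_(m, p)) i j :
  ((selmx R n tau)^T *m A) i j = A (enum_val (cast_ord (esym ntau) i)) j.
Proof.
rewrite mxE (bigD1 (enum_val (cast_ord (esym ntau) i))) //=.
rewrite (tr_selmxE ntau) eqxx mul1r big1 ?addr0 // => k /negPf nk.
by rewrite (tr_selmxE ntau) eq_sym nk mul0r.
Qed.

Lemma selmx_ones n tau : #|tau| = n -> (selmx R n tau)^T *m ones R m = ones R n.
Proof. by move=> ntau; apply/matrixP=> i j; rewrite (mul_tr_selmx ntau) !mxE. Qed.

Lemma selmx_mul_tr n tau : #|tau| = n ->
  selmx R n tau *m (selmx R n tau)^T = diag_mx (\row_i (i \in tau)%:R).
Proof.
move=> ntau; apply/matrixP=> i j; rewrite !mxE.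
transitivity (\sum_(k in tau) ((k == i)%:R * (k == j)%:R : R)).
  rewrite (big_enum_val_cast _ ntau); apply: eq_bigr => k _.
  by rewrite -!(tr_selmxE ntau) [in RHS]mxE.
have [itau|itau] := boolP (i \in tau); last first.
  rewrite mul0rn big1 // => k ktau; have [eki|] := eqVneq k i; last by rewrite mul0r.
  by rewrite -eki ktau in itau.
rewrite (bigD1 i) //= eqxx mul1r big1 ?addr0 // => k /andP[_ /negPf->].
by rewrite mul0r.
Qed.

Lemma det_selmx_diagc n tau (A : 'M[R]_(m, n)) x : #|tau| = n ->
  \det ((selmx R n tau)^T *m diagc x *m A) =
  subset_prod x tau * \det ((selmx R n tau)^T *m A).
Proof.
move=> ntau.
have -> : (selmx R n tau)^T *m diagc x *m A =
    diag_mx (\row_k x (enum_val (cast_ord (esym ntau) k)) 0)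
      *m ((selmx R n tau)^T *m A).
  rewrite -mulmxA; apply/matrixP=> i j.
  rewrite (mul_tr_selmx ntau) !mul_diag_mx [LHS]mxE [RHS]mxE.
  by rewrite (mul_tr_selmx ntau) !mxE.
rewrite det_mulmx det_diag /subset_prod; congr (_ * _).
by rewrite (big_enum_val_cast _ ntau); apply: eq_bigr => k _; rewrite mxE.
Qed.

Lemma det_selmx_vandermonde n tau lam : #|tau| = n ->
  \det ((selmx R n tau)^T *m vandermonde n lam) ^+ 2 =
  \prod_(i in tau) \prod_(j in tau | (j < i)%N) (lam i 0 - lam j 0) ^+ 2.
Proof.
move=> ntau.
have -> : (selmx R n tau)^T *m vandermonde n lam =
    (Vandermonde n (\row_k lam (enum_val (cast_ord (esym ntau) k)) 0))^T.
  by apply/matrixP=> i j; rewrite (mul_tr_selmx ntau) !mxE.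
(* The determinant formula has the smaller index outside; the exchange puts the larger one there, as
   in [pi_weight]. *)
rewrite det_tr det_Vandermonde (exchange_big_dep xpredT) //= -prodrXl.
rewrite (big_enum_val_cast _ ntau); apply: eq_bigr => i _.
rewrite big_mkcondr (big_enum_val_cast _ ntau) -big_mkcond -prodrXl /=.
by apply: eq_big => [j|j _]; rewrite ?ltn_enum_val // !mxE.
Qed.

(** Multilinearity in the rows: row i of A B is a combination of the rows of B, and [f] picks one of
    them for each i. *)
Lemma det_mulmx_row n (A : 'M[R]_(n, m)) (B : 'M[R]_(m, n)) :
  \det (A *m B) =
  \sum_(f : {ffun 'I_n -> 'I_m}) \prod_i A i (f i) * \det (rowsub f B).
Proof.
rewrite /determinant.
transitivity (\sum_(f : {ffun 'I_n -> 'I_m}) \sum_(s : 'S_n)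
    (-1) ^+ s * \prod_i (A i (f i) * B (f i) (s i))).
  rewrite exchange_big; apply: eq_bigr => /= s _; rewrite -big_distrr /=.
  congr (_ * _); rewrite -(bigA_distr_bigA (fun i j => A i j * B j (s i))) /=.
  by apply: eq_bigr => i _; rewrite mxE.
apply: eq_bigr => f _; rewrite big_distrr; apply: eq_bigr => s _ /=.
rewrite big_split mulrCA; congr (_ * (_ * _)).
by apply: eq_bigr => i _; rewrite mxE.
Qed.

(* The tau-summand is det(A D B) with D the diagonal projector onto tau, that
   is, the part of the expansion of det(A B) over maps f with image in tau.
   Non-injective f contribute 0; the image of an injective f lies in exactly
   one n-subset. *)
Lemma cauchy_binet n (A : 'M[R]_(n, m)) (B : 'M[R]_(m, n)) :
  \det (A *m B) =
  \sum_(tau in nsubsets m n)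
    \det (A *m selmx R n tau) * \det ((selmx R n tau)^T *m B).
Proof.
transitivity (\sum_(tau in nsubsets m n)
    \sum_(f : {ffun 'I_n -> 'I_m})
      (f @: 'I_n \subset tau)%:R * (\prod_i A i (f i) * \det (rowsub f B))).
  rewrite det_mulmx_row exchange_big /=; apply: eq_bigr => f _.
  have [/injectiveP injf|/injectivePn[i [j nij fij]]] := boolP (injectiveb f).
    rewrite (bigD1 (f @: 'I_n)) ?inE ?card_imset ?card_ord //= subxx mul1r.
    rewrite [X in _ + X]big1 ?addr0 // => tau; rewrite inE => /andP[/eqP ntau neq].
    case: (boolP (_ \subset _)) => [sub|]; last by rewrite mul0r.
    case/eqP: neq; apply/esym/eqP.
    by rewrite eqEcard sub ntau card_imset // card_ord leqnn.
  have -> : \det (rowsub f B) = 0.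
    by rewrite (determinant_alternate nij) // => k; rewrite !mxE fij.
  by rewrite mulr0 big1 // => tau _; rewrite !mulr0.
apply: eq_bigr => tau; rewrite inE => /eqP ntau.
rewrite -det_mulmx -mulmxA (mulmxA (selmx _ _ _)) selmx_mul_tr // mulmxA.
rewrite det_mulmx_row; apply: eq_bigr => f _; rewrite mulrA; congr (_ * _).
(* The projector gives a factor [f i \in tau] for each i; their product is the indicator of the
   image lying in [tau]. *)
under [RHS]eq_bigr do rewrite mul_mx_diag !mxE.
rewrite big_split /= mulrC; congr (_ * _).
have [/subsetP sub|/subsetPn[_ /imsetP[i _ ->] nfi]] := boolP (_ \subset _).
  by rewrite big1 // => i _; rewrite sub ?imset_f.
by rewrite (bigD1 i) //= (negPf nfi) mul0r.
Qed.

End Selection.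

(** * Cramer's rule with adjugates *)

Definition set_col (R : Type) m n (k : 'I_n) (b : 'cV[R]_m) (A : 'M[R]_(m, n)) :=
  \matrix_(i, j) if j == k then b i 0 else A i j.

Lemma mulmx_set_col (R : comPzRingType) p m n (k : 'I_n)
    (X : 'M[R]_(p, m)) (b : 'cV[R]_m) (A : 'M[R]_(m, n)) :
  X *m set_col k b A = set_col k (X *m b) (X *m A).
Proof.
apply/matrixP=> i j; rewrite !mxE; have [->|nk] := eqVneq j k; apply: eq_bigr => l _.
  by rewrite mxE eqxx.
by rewrite mxE (negPf nk).
Qed.

Lemma adj_mul_col (R : comPzRingType) n (k : 'I_n) (b : 'cV[R]_n) (A : 'M[R]_n) :
  (\adj A *m b) k 0 = \det (set_col k b A).
Proof.
rewrite (expand_det_col _ k) mxE; apply: eq_bigr => i _.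
rewrite !mxE eqxx mulrC; congr (_ * (_ * \det _)).
(* The cofactors along column k do not see the replaced column. *)
by apply/matrixP=> r c; rewrite !mxE eq_sym (negPf (neq_lift _ _)).
Qed.

(** Entry k is Cauchy-Binet for A times B with column k replaced by b. Adjugates make it valid
    without any invertibility. *)
Lemma cauchy_binet_adj (R : realFieldType) m n
    (A : 'M[R]_(n, m)) (B : 'M[R]_(m, n)) (b : 'cV[R]_m) :
  \adj (A *m B) *m (A *m b) =
  \sum_(tau in nsubsets m n) \det (A *m selmx R n tau) *:
    (\adj ((selmx R n tau)^T *m B) *m ((selmx R n tau)^T *m b)).
Proof.
apply/colP=> k; rewrite adj_mul_col -mulmx_set_col cauchy_binet summxE.
by apply: eq_bigr => tau _; rewrite [in RHS]mxE adj_mul_col mulmx_set_col.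
Qed.

Lemma adj_unitmx (R : comUnitRingType) n (A : 'M[R]_n) :
  A \in unitmx -> \adj A = \det A *: invmx A.
Proof. by move=> uA; rewrite /invmx uA scalerA divrr ?scale1r -?unitmxE. Qed.

(** * The weights and the determinant of the PLS matrix *)

Section Gram.

Variables (R : realFieldType) (m n : nat).
Implicit Types (lam psi : 'cV[R]_m) (tau : {set 'I_m}).

(** The second determinant is [subset_prod lam tau] times the first, whose square is the product of
    squared differences. *)
Lemma pi_weightE lam tau : #|tau| = n ->
  pi_weight lam tau = \det ((selmx R n tau)^T *m vandermonde n lam) *
    \det ((selmx R n tau)^T *m diagc lam *m vandermonde n lam).
Proof.
by move=> ntau; rewrite det_selmx_diagc // mulrCA -expr2 det_selmx_vandermonde.
Qed.

Lemma det_vandermonde_diagc_selmx lam psi tau : #|tau| = n ->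
  \det ((vandermonde n lam)^T *m diagc psi *m selmx R n tau) =
  subset_prod psi tau * \det ((selmx R n tau)^T *m vandermonde n lam).
Proof.
move=> ntau; rewrite -det_selmx_diagc // -[LHS]det_tr; congr (\det _).
by rewrite !trmx_mul trmxK tr_diag_mx mulmxA.
Qed.

Lemma det_gram lam psi :
  \det ((vandermonde n lam)^T *m diagc psi *m diagc lam *m vandermonde n lam) =
  \sum_(tau in nsubsets m n) subset_prod psi tau * pi_weight lam tau.
Proof.
rewrite -[_ *m diagc lam *m _]mulmxA cauchy_binet; apply: eq_bigr => tau.
rewrite inE => /eqP ntau; rewrite det_vandermonde_diagc_selmx // pi_weightE //.
by rewrite mulmxA mulrA.
Qed.

Lemma pi_weight_gt0 lam tau :
    (forall i j : 'I_m, (i < j)%N -> lam j 0 < lam i 0) ->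
    (forall i, 0 < lam i 0) ->
  0 < pi_weight lam tau.
Proof.
move=> lam_decr lam_gt0; rewrite mulr_gt0 ?prodr_gt0 // => i _.
apply: prodr_gt0 => j /andP[_ ltji].
by rewrite exprn_even_gt0 //= subr_eq0 lt_eqF ?lam_decr.
Qed.

(** All summands are nonnegative, and any n-subset of the support of [psi] contributes a positive
    one. *)
Lemma sum_weight_gt0 lam psi :
    (forall i j : 'I_m, (i < j)%N -> lam j 0 < lam i 0) ->
    (forall i, 0 < lam i 0) -> (forall i, 0 <= psi i 0) ->
    (n <= #|[set i | (psi i 0 != 0)%R]|)%N ->
  0 < \sum_(tau in nsubsets m n) subset_prod psi tau * pi_weight lam tau.
Proof.
move=> lam_decr lam_gt0 psi_ge0 /card_geqP[s [uniq_s size_s s_sub]].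
have pi_gt0 tau := pi_weight_gt0 tau lam_decr lam_gt0.
have s_in : [set i in s] \in nsubsets m n.
  by rewrite inE cardsE (card_uniqP uniq_s) size_s.
rewrite (bigD1 _ s_in) ltr_pwDl //= ?sumr_ge0 // => [|tau _].
  rewrite mulr_gt0 // prodr_gt0 // => i; rewrite inE => /s_sub.
  by rewrite inE lt0r psi_ge0 andbT.
by rewrite mulr_ge0 ?(ltW (pi_gt0 _)) // prodr_ge0.
Qed.

End Gram.

Theorem theorem2p3 (R : realFieldType) (m n : nat) (hn : (1 <= n)%N)
    (hnm : (n < m)%N) (lam : 'cV[R]_m)
    (hlam_decr : forall i j : 'I_m, (i < j)%N -> lam j 0 < lam i 0)
    (hlam_pos : forall i : 'I_m, 0 < lam i 0)
    (y : 'cV[R]_m)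
    (hy : (n <= #|[set i : 'I_m | (psi y i 0 != 0)%R]|)%N) :
  pls_shrinkage n lam y =
    (\sum_(tau in nsubsets m n) subset_prod (psi y) tau * pi_weight lam tau)^-1
    *: \sum_(tau in nsubsets m n)
         (subset_prod (psi y) tau * pi_weight lam tau) *: omega_sub n lam tau.
Proof.
have psi_ge0 i : 0 <= psi y i 0 by rewrite mxE sqr_ge0.
have sum_gt0 := sum_weight_gt0 hlam_decr hlam_pos psi_ge0 hy.
have unitM : (vandermonde n lam)^T *m diagc (psi y) *m diagc lam
    *m vandermonde n lam \in unitmx.
  by rewrite unitmxE unitfE det_gram gt_eqF.
(* The inverse becomes adjugate over determinant; the determinant is the normalising sum, leaving an
   identity between adjugates. *)
rewrite /pls_shrinkage /pls_Q /= {1}/invmx unitM det_gram.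
rewrite -scalemxAr -!scalemxAl; congr (_ *: _).
rewrite -!(mulmxA (_ *m vandermonde n lam)) -[_ *m diagc lam *m _]mulmxA.
rewrite -!(mulmxA (\adj _)) cauchy_binet_adj mulmx_sumr; apply: eq_bigr => tau.
(* The determinant of the selected block divides [pi_weight lam tau], which is positive, so its
   adjugate turns back into an inverse. *)
rewrite inE => /eqP ntau; rewrite mulmxA selmx_ones // adj_unitmx; last first.
  rewrite unitmxE unitfE; apply: contraTneq (pi_weight_gt0 tau hlam_decr hlam_pos).
  by rewrite (pi_weightE _ ntau) => ->; rewrite mulr0 ltxx.
rewrite det_vandermonde_diagc_selmx // (pi_weightE _ ntau).
rewrite -scalemxAl scalerA -scalemxAr mulrA.
by rewrite /omega_sub !mulmxA.
Qed.
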